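(* Let $G=(V,E)$ be a regular bipartite graph of vertex degree $d$. Then we have $$\nu(G)\le d-\sqrt d.$$ Moreover, we have the following equivalences for magnetic potentials $\sigma:E^{or}(G)\to S^1$ in $d$-regular bipartite graphs: (i) $\lambda_1^\sigma(G)=d-\sqrt d$, that is, $\sigma$ is a maximal potential; (ii) $(A^\sigma)^2=d\cdot\mathrm{Id}$; (iii) $\Delta^\sigma$ has precisely two eigenvalues $d\pm\sqrt d$, each with multiplicity $|V|/2$; (iv) for any two vertices $x,y\in V$ at distance $2$, $$\sum_{z:\,x\sim z\sim y}\sigma(x,z)\sigma(z,y)=0.$$
   Context: All graphs $G=(V,E)$ are finite and simple; $x\sim y$ denotes adjacency. $E^{or}(G)$ is the set of ordered pairs $(x,y)$ with $x\sim y$. A magnetic potential is a map $\sigma:E^{or}(G)\to S^1=\{z\in\mathbb{C}:|z|=1\}$ with $\sigma(y,x)=\sigma(x,y)^{-1}$. The magnetic Laplacian on functions $f:V\to\mathbb{C}$ is $\Delta^\sigma f(x)=\sum_{y\sim x}(f(x)-\sigma(x,y)f(y))$, and $\lambda_1^\sigma(G)$ is its smallest eigenvalue. The magneto-spectral height is $\nu(G)=\sup_\sigma\lambda_1^\sigma(G)$, over all magnetic potentials; $\sigma$ is called maximal if $\lambda_1^\sigma(G)=\nu(G)$. The Hermitian magnetic adjacency matrix is $A^\sigma=d\cdot\mathrm{Id}-\Delta^\sigma$ with respect to any enumeration of the vertices.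
   Formalization: The equivalence with (iii) is stated only for d > 0, since for d = 0 (i), (ii), (iv) hold but (iii) fails; and ''σ is a maximal potential'' is stated only as a consequence of (i), since on the hexagon a maximal σ has λ₁ = 2−√3 < 2−√2. V is assumed nonempty. *)

(* Defs.v *)
From HB Require Import structures.
From mathcomp Require Import all_boot all_order all_algebra.
From mathcomp Require Import complex.
From mathcomp Require Import boolp classical_sets reals.

Set Implicit Arguments.
Unset Strict Implicit.
Unset Printing Implicit Defensive.

Import Order.TTheory GRing.Theory Num.Theory.
Import passmx.

Local Open Scope complex_scope.
Local Open Scope ring_scope.
Local Open Scope classical_set_scope.

(* A finite simple graph is a symmetric irreflexive relation on a finType. *)
Section Graph.
Variables (V : finType) (e : rel V).

Definition regular (d : nat) : Prop :=
  forall x : V, #|[pred y | e x y]| = d.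

Definition bipartite : Prop :=
  exists A : {set V}, forall x y : V, e x y -> (x \in A) != (y \in A).

(* [x :: p] ranges over the walks that start at [x]; the shortest one that
   reaches [y] has exactly [k] edges. *)
Definition at_distance (k : nat) (x y : V) : Prop :=
  (exists p : seq V, [/\ path e x p, last x p = y & size p = k]) /\
  (forall p : seq V, path e x p -> last x p = y -> (k <= size p)%N).

End Graph.

Section Magnetic.
Variables (R : realType) (V : finType) (e : rel V).

(* A potential is a total function constrained on the ordered edges only; its
   values on non-adjacent pairs are irrelevant, as every sum below ranges over
   edges. *)
Definition magnetic_potential (sigma : V -> V -> R[i]) : Prop :=
  forall x y : V, e x y ->
    `|sigma x y| = 1 /\ sigma y x = (sigma x y)^-1.

Definition laplacian_fun (sigma : V -> V -> R[i]) (f : {ffun V -> R[i]^o}) :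
    {ffun V -> R[i]^o} :=
  [ffun x => \sum_(y | e x y) (f x - sigma x y * f y)].

Lemma laplacian_fun_is_linear (sigma : V -> V -> R[i]) :
  linear (laplacian_fun sigma).
Proof.
move=> a f g; apply/ffunP => x; rewrite !ffunE scaler_sumr -big_split /=.
apply: eq_bigr => y _; rewrite !ffunE /GRing.scale /= mulrDr mulrBr.
by rewrite [sigma x y * (_ * _)]mulrCA opprD addrACA.
Qed.

HB.instance Definition _ (sigma : V -> V -> R[i]) :=
  GRing.isLinear.Build R[i] {ffun V -> R[i]^o} {ffun V -> R[i]^o} _
    (laplacian_fun sigma) (laplacian_fun_is_linear sigma).

Definition magnetic_laplacian (sigma : V -> V -> R[i]) :
    'End({ffun V -> R[i]^o}) :=
  linfun (laplacian_fun sigma).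

Lemma magnetic_laplacianE (sigma : V -> V -> R[i]) (f : {ffun V -> R[i]^o})
    (x : V) :
  magnetic_laplacian sigma f x = \sum_(y | e x y) (f x - sigma x y * f y).
Proof. by rewrite lfunE ffunE. Qed.

(* For nonempty [V] this infimum is the smallest eigenvalue: [lambda1_min]
   below. *)
Definition lambda1 (sigma : V -> V -> R[i]) : R :=
  inf [set r : R | leigenvalue (magnetic_laplacian sigma) r%:C].

Definition magneto_spectral_height : R :=
  sup [set lambda1 sigma | sigma in magnetic_potential].

Definition maximal_potential (sigma : V -> V -> R[i]) : Prop :=
  magnetic_potential sigma /\ lambda1 sigma = magneto_spectral_height.

(* Column-vector convention: [laplacian_mx v sigma *m c] is the coordinate
   vector of the Laplacian of the function with coordinate vector [c]. *)
Definition laplacian_mx (n : nat) (v : 'I_n -> V) (sigma : V -> V -> R[i]) :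
    'M[R[i]]_n :=
  \matrix_(i, j)
    magnetic_laplacian sigma [ffun x => (x == v j)%:R] (v i).

Definition magnetic_adjacency (d : nat) (n : nat) (v : 'I_n -> V)
    (sigma : V -> V -> R[i]) : 'M[R[i]]_n :=
  d%:R%:M - laplacian_mx v sigma.

Lemma magnetic_eigenvalueP (sigma : V -> V -> R[i]) (a : R[i]) :
  leigenvalue (magnetic_laplacian sigma) a <->
  exists2 f : {ffun V -> R[i]^o}, f != 0 & magnetic_laplacian sigma f = a *: f.
Proof.
move: (magnetic_laplacian sigma) => D; split=> [nz|[f f0 fE]].
- exists (vpick (leigenspace D a)); first by rewrite vpick0.
  have := memv_pick (leigenspace D a).
  by rewrite memv_ker !lfun_simp subr_eq0 => /eqP.
- apply: contraNneq f0 => E0; rewrite -memv0 -E0 memv_ker.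
  by rewrite !lfun_simp fE subrr.
Qed.

Lemma magnetic_spectrum (sigma : V -> V -> R[i]) : exists s : seq R[i],
  forall a, leigenvalue (magnetic_laplacian sigma) a = (a \in s).
Proof.
set D := magnetic_laplacian sigma.
have eb := vbasisP {:{ffun V -> R[i]^o}}.
set p := char_poly (mxof (vbasis {:{ffun V -> R[i]^o}}) (vbasis {:_}) D).
have p0 : p != 0 by apply: monic_neq0; exact: char_poly_monic.
have [s ps] := closed_field_poly_normal p.
exists s => a.
rewrite /leigenvalue (leigenspaceE eb) (vsof_eq0 eb).
rewrite -[LHS]/(eigenvalue _ _) eigenvalue_root_char -/p ps.
by rewrite rootZ ?lead_coef_eq0// root_prod_XsubC.
Qed.

Lemma magnetic_eigenvalue_exists (sigma : V -> V -> R[i]) :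
  (0 < #|V|)%N -> exists a, leigenvalue (magnetic_laplacian sigma) a.
Proof.
move=> V0; set D := magnetic_laplacian sigma.
have eb := vbasisP {:{ffun V -> R[i]^o}}.
have /eigenvalue_closed : (0 < \dim {:{ffun V -> R[i]^o}})%N.
  have /card_gt0P[x _] := V0.
  rewrite lt0n dimv_eq0 -subv0; apply/negP => /subvP /(_ [ffun=> 1]).
  rewrite memvf memv0 => /(_ isT) /eqP /ffunP /(_ x).
  by rewrite !ffunE => /eqP; rewrite oner_eq0.
move=> /(_ _ (mxof (vbasis {:_}) (vbasis {:_}) D)) [a ea]; exists a.
by rewrite /leigenvalue (leigenspaceE eb) (vsof_eq0 eb).
Qed.

Lemma magnetic_eigenvalue_real (sigma : V -> V -> R[i]) (a : R[i]) :
  symmetric e -> magnetic_potential sigma ->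
  leigenvalue (magnetic_laplacian sigma) a -> a \is Num.real.
Proof.
move=> e_sym ms /magnetic_eigenvalueP[f f0 fE].
pose g x : R[i] := f x.
pose N := \sum_x g x * (g x)^*.
have N0 : 0 < N.
  have N_ge0 x : true -> 0 <= g x * (g x)^* by rewrite mul_conjC_ge0.
  rewrite lt_neqAle sumr_ge0// andbT eq_sym; apply: contra f0 => /eqP N0.
  apply/eqP/ffunP => x; rewrite ffunE; apply/eqP.
  by rewrite -mul_conjC_eq0; apply/eqP; apply: (psumr_eq0P N_ge0 N0).
have aN : a * N = \sum_x \sum_(y | e x y) (g x * (g x)^* - sigma x y * g y * (g x)^*).
  rewrite mulr_sumr; apply: eq_bigr => x _.
  rewrite mulrA; have -> : a * g x = magnetic_laplacian sigma f x.
    by rewrite fE ffunE.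
  rewrite magnetic_laplacianE mulr_suml; apply: eq_bigr => y _.
  by rewrite mulrBl.
suff aNC : (a * N)^* = a * N.
  have /CrealP aNr := aNC.
  by rewrite -[a](mulfK (lt0r_neq0 N0)) rpredM// rpredV gtr0_real.
have conjE x y : e x y ->
    (g x * (g x)^* - sigma x y * g y * (g x)^*)^* =
    g x * (g x)^* - sigma y x * g x * (g y)^*.
  move=> /ms[nxy ->]; rewrite rmorphB !rmorphM /= !conjCK; congr (_ - _).
    by rewrite mulrC.
  have -> : (sigma x y)^-1 = (sigma x y)^* by rewrite invC_norm nxy expr1n invr1 mul1r.
  by rewrite -!mulrA; congr (_ * _); rewrite mulrC.
rewrite aN rmorph_sum /= (eq_bigr (fun x => \sum_(y | e x y) g x * (g x)^* -
    \sum_(y | e x y) sigma y x * g x * (g y)^*)); last first.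
  by move=> x _; rewrite rmorph_sum -sumrB; apply: eq_bigr => y /conjE.
rewrite sumrB [RHS](eq_bigr (fun x => \sum_(y | e x y) g x * (g x)^* -
    \sum_(y | e x y) sigma x y * g y * (g x)^*)); last first.
  by move=> x _; rewrite -sumrB.
rewrite sumrB; congr (_ - _).
rewrite (exchange_big_dep xpredT)//=; apply: eq_bigr => x _.
by apply: eq_bigl => y; rewrite e_sym.
Qed.

Lemma lambda1_min (sigma : V -> V -> R[i]) :
  symmetric e -> (0 < #|V|)%N -> magnetic_potential sigma ->
  leigenvalue (magnetic_laplacian sigma) (lambda1 sigma)%:C /\
  forall a, leigenvalue (magnetic_laplacian sigma) a -> (lambda1 sigma)%:C <= a.
Proof.
move=> e_sym V0 ms; set D := magnetic_laplacian sigma.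
have toR a : leigenvalue D a -> (complex.Re a)%:C = a.
  by move=> /(magnetic_eigenvalue_real e_sym ms) /RRe_real.
have [s sE] := magnetic_spectrum sigma.
have [a0 ea0] := magnetic_eigenvalue_exists sigma V0.
have [b eb bmin] : exists2 b, leigenvalue D b &
    forall a, leigenvalue D a -> complex.Re b <= complex.Re a.
  have a0s : a0 \in s by rewrite -sE.
  case: (@arg_minP _ R (seq_sub s) (SeqSub a0s) xpredT
    (fun u => complex.Re (val u))) => // u _ umin.
  exists (val u); first by rewrite sE; exact: valP.
  by move=> a; rewrite sE => as_; exact: (umin (SeqSub as_)).
have lE : lambda1 sigma = complex.Re b.
  apply/eqP; rewrite eq_le; apply/andP; split.
    apply: ge_inf; last by rewrite /= toR.
    by exists (complex.Re b) => r /= /bmin.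
  apply: lb_le_inf; first by exists (complex.Re b); rewrite /= toR.
  by move=> r /= /bmin.
by rewrite lE toR//; split=> // a ea; rewrite -(toR a ea) -[leLHS](toR b eb) lecR bmin.
Qed.

End Magnetic.

(* Main.v *)
From HB Require Import structures.
Require Import Defs.
From mathcomp Require Import all_boot all_order all_algebra.
From mathcomp Require Import complex.
From mathcomp Require Import boolp classical_sets reals.

Set Implicit Arguments.
Unset Strict Implicit.
Unset Printing Implicit Defensive.

Import Order.TTheory GRing.Theory Num.Theory.
Import passmx.

Local Open Scope complex_scope.
Local Open Scope ring_scope.

(** Why the theorem holds.  Write [A] for the magnetic adjacency matrix, a
    Hermitian matrix of size [n = #|V|] whose eigenvalues are the numbers
    [d - a] with [a] an eigenvalue of the Laplacian, and let
    [mu = d - lambda1] be its largest eigenvalue.  Two facts drive everything.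

    - Multiplying a function by [-1] on one side of the bipartition turns the
      Laplacian [Delta] into [2 d - Delta].  The spectrum of [A] is therefore
      symmetric about [0], with multiplicities
      ([dim_leigenspace_reflect]), so [mu] bounds the absolute value of every
      eigenvalue of [A].

    - The diagonal entries of [A^2] are sums of [sigma x z * sigma z x = 1]
      over the [d] neighbours [z] of [x], so [A^2] has trace [n d]
      ([magnetic_adjacency_sqr_diag]).

    The trace of [A^2] is the sum of the squares of the [n] eigenvalues of
    [A], each at most [mu^2]; hence [d <= mu^2], that is
    [lambda1 <= d - sqrt d].  If equality holds, every eigenvalue of [A^2]
    equals [d] and [A^2], being diagonalizable, is [d] times the identity
    ([tr_sqr_hermitian], [degree_le_sqr_gap]).

    Conversely, [A^2 = d] forces the eigenvalues of [A] to be [sqrt d] or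
    [- sqrt d]; since [mu] is nonnegative, it is [sqrt d]
    ([lambda1_eq_sqr_adjacency]).  For [d > 0] the two eigenspaces then span
    the whole space and have equal dimensions by the spectral symmetry, which gives
    [iii] ([spectrum_of_sqr_adjacency]), while [iii] implies [i] because
    [lambda1] is the smallest eigenvalue.  Finally [iv] is [A^2 = d] read
    entrywise: an off-diagonal entry of [A^2] is an empty sum unless its
    vertices have a common neighbour, and in a bipartite graph distinct
    vertices with a common neighbour are at distance exactly [2]
    ([at_distance2_iff], [sqr_adjacency_distance2]). *)

(** * Linear algebra *)

(** In a unitary eigenbasis the trace is the sum of the squared eigenvalues,
    which a bound on each of them controls; when the sum attains the bound,
    so does each term, and [A *m A] is a scalar matrix in that basis, hence in
    every basis. *)
Lemma tr_sqr_hermitian (C : numClosedFieldType) (n : nat) (A : 'M[C]_n) (m : C) :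
  A \is hermsymmx ->
  (forall a (c : 'cV_n), c != 0 -> A *m c = a *: c -> a ^+ 2 <= m) ->
  \tr (A *m A) <= m *+ n /\ (\tr (A *m A) = m *+ n -> A *m A = m%:M).
Proof.
move=> /hermitian_normalmx/orthomx_spectralP.
set P := spectralmx A; set sp := spectral_diag A => AE bnd.
have Pu : P \in unitmx by exact: spectral_unit.
have AAE : A *m A = invmx P *m diag_mx (\row_j (sp 0 j ^+ 2)) *m P.
  rewrite AE !mulmxA mulmxK// -!mulmxA [X in _ *m X]mulmxA mulmx_diag.
  by congr (_ *m (diag_mx _ *m _)); apply/rowP => j; rewrite !mxE.
have spP j : sp 0 j ^+ 2 <= m.
  apply: (bnd _ (col j (invmx P))).
    apply/eqP => /(congr1 (mulmx P)).
    rewrite colE mulKVmx// mulmx0 => /colP/(_ j)/eqP.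
    by rewrite !mxE !eqxx oner_eq0.
  rewrite {1}AE colE !mulmxA mulmxK//.
  by rewrite -!colE mul_mx_diag; apply/colP => i; rewrite !mxE mulrC.
have trE : \tr (A *m A) = \sum_j sp 0 j ^+ 2.
  rewrite AAE mxtrace_mulC mulmxA mulmxV// mul1mx mxtrace_diag.
  by apply: eq_bigr => j _; rewrite mxE.
have mE : m *+ n = \sum_(j < n) m by rewrite sumr_const card_ord.
rewrite trE mE; split; first exact: ler_sum.
move=> eqs; have eqj j : sp 0 j ^+ 2 = m.
  apply/esym/eqP; rewrite -subr_eq0; apply/eqP.
  apply: (@psumr_eq0P _ _ xpredT (fun j => m - sp 0 j ^+ 2)) => //.
    by move=> k _; rewrite subr_ge0.
  by rewrite sumrB eqs subrr.
rewrite AAE (_ : \row_j _ = const_mx m); last first.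
  by apply/rowP => j; rewrite !mxE eqj.
by rewrite diag_const_mx mul_mx_scalar -scalemxAl mulVmx// scalemx1.
Qed.

Section Endomorphism.
Variables (K : fieldType) (vT : vectType K).
Implicit Types (D : 'End(vT)) (a : K) (u : vT).

Lemma memv_leigenspaceP D a u :
  reflect (D u = a *: u) (u \in leigenspace D a).
Proof. by rewrite memv_ker !lfun_simp subr_eq0; exact: eqP. Qed.

Lemma leigenvalueP D a :
  reflect (exists2 u, u != 0 & D u = a *: u) (leigenvalue D a).
Proof.
apply: (iffP idP) => [a_eig|[u u0 /memv_leigenspaceP u_eig]]; last first.
  by apply: contraNneq u0 => E0; rewrite -memv0 -E0.
exists (vpick (leigenspace D a)); first by rewrite vpick0.
exact/memv_leigenspaceP/memv_pick.
Qed.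

Lemma leigenspace_subr D m a :
  leigenspace (m *: \1%VF - D) a = leigenspace D (m - a).
Proof.
apply/vspaceP => u; apply/memv_leigenspaceP/memv_leigenspaceP.
  by rewrite !lfun_simp scalerBl => <-; rewrite subKr.
by rewrite !lfun_simp scalerBl => ->; rewrite subKr.
Qed.

Lemma dim_le_injective (f : 'End(vT)) (U W : {vspace vT}) :
  lker f = 0%VS -> (forall u, u \in U -> f u \in W) -> (\dim U <= \dim W)%N.
Proof.
move=> f_inj fUW; rewrite -(limg_dim_eq (f := f) (U := U)) ?f_inj ?capv0//.
by apply/dimvS/subvP => _ /memv_imgP[u uU ->]; exact: fUW.
Qed.

(** An operator whose square is the scalar [q ^+ 2] is, when [2 * q] is
    invertible, diagonalizable with eigenvalues [q] and [- q]. *)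
Section SquareScalar.
Variables (T : 'End(vT)) (q : K).
Hypothesis TT : forall u, T (T u) = q ^+ 2 *: u.

Lemma leigenvalue_sqr_scalar a : leigenvalue T a -> a = q \/ a = - q.
Proof.
move=> /leigenvalueP[u u0 ua]; have := TT u.
rewrite ua linearZ /= ua scalerA => /eqP.
rewrite -subr_eq0 -scalerBl scaler_eq0 (negPf u0) orbF -expr2 subr_eq0 eqf_sqr.
by case/orP => /eqP; [left|right].
Qed.

(** Up to a factor [2], this is the projection of [u] onto the eigenspace of
    [r]: it comes from the factorization [T^2 - r^2 = (T - r) (T + r)]. *)
Lemma add_sqr_eigenvector r u : r != 0 -> r ^+ 2 = q ^+ 2 ->
  u + r^-1 *: T u \in leigenspace T r.
Proof.
move=> r0 rq; apply/memv_leigenspaceP.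
rewrite linearD linearZ /= TT -rq scalerA expr2 mulKf// scalerDr scalerA.
by rewrite mulfV// scale1r addrC.
Qed.

Lemma dim_sqr_scalar : 2 * q != 0 ->
  (\dim (leigenspace T q) + \dim (leigenspace T (- q)))%N = \dim {:vT}.
Proof.
rewrite mulf_eq0 negb_or => /andP[two0 q0].
rewrite -dimv_disjoint_sum; last first.
  apply/eqP; rewrite -subv0; apply/subvP => u.
  rewrite memv_cap => /andP[/memv_leigenspaceP u1 /memv_leigenspaceP].
  rewrite u1 memv0 => /eqP; rewrite -subr_eq0 -scalerBl scaler_eq0 opprK.
  by rewrite -mulr2n -mulr_natl mulf_eq0 (negPf two0) (negPf q0).
congr (\dim _); apply/eqP; rewrite eqEsubv subvf; apply/subvP => u _.
have -> : u = 2^-1 *: (u + q^-1 *: T u) + 2^-1 *: (u + (- q)^-1 *: T u).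
  rewrite -scalerDr invrN scaleNr addrACA subrr addr0 -mulr2n -scaler_nat.
  by rewrite scalerA mulVf ?scale1r.
by apply: memv_add; apply: memvZ; apply: add_sqr_eigenvector;
  rewrite ?oppr_eq0 ?sqrrN.
Qed.

End SquareScalar.
End Endomorphism.

(** * The magnetic adjacency matrix *)

Section Magnetic.
Variables (R : realType) (V : finType) (e : rel V) (d : nat).
Hypotheses (e_sym : symmetric e) (e_reg : regular e d).
Implicit Types (sigma : V -> V -> R[i]) (f : {ffun V -> R[i]^o}).

Lemma laplacian_regular sigma f x :
  magnetic_laplacian e sigma f x =
  d%:R * f x - \sum_(y | e x y) sigma x y * f y.
Proof.
by rewrite magnetic_laplacianE sumrB sumr_const (e_reg x) mulr_natl.
Qed.

Section Enumeration.
Variables (n : nat) (v : 'I_n -> V) (v_bij : bijective v).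
Variable sigma : V -> V -> R[i].
Let A := magnetic_adjacency e d v sigma.

Lemma magnetic_adjacencyE i j :
  A i j = if e (v i) (v j) then sigma (v i) (v j) else 0.
Proof.
rewrite !mxE laplacian_regular ffunE (inj_eq (bij_inj v_bij)) mulr_natr.
rewrite subKr big_mkcond (bigD1 (v j)) //= ffunE eqxx mulr1 big1 ?addr0 //.
by move=> y /negPf yj; rewrite ffunE yj mulr0 if_same.
Qed.

(** Identifies the matrix [A] with the operator [d - Delta], so that facts on
    eigenvectors and squares pass between the two. *)
Lemma magnetic_adjacency_col f :
  A *m \col_i (f (v i) : R[i]) =
  \col_i (d%:R * f (v i) - magnetic_laplacian e sigma f (v i)).
Proof.
apply/colP => i; rewrite !mxE laplacian_regular subKr.
rewrite [RHS]big_mkcond (reindex v) /=; last exact: onW_bij.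
by apply: eq_bigr => j _; rewrite magnetic_adjacencyE mxE; case: ifP; rewrite ?mul0r.
Qed.

Lemma magnetic_adjacency_sqrE i j :
  (A *m A) i j =
  \sum_(z | e (v i) z && e z (v j)) sigma (v i) z * sigma z (v j).
Proof.
rewrite mxE [RHS]big_mkcond (reindex v) /=; last exact: onW_bij.
apply: eq_bigr => k _; rewrite !magnetic_adjacencyE.
by case: ifP => _; case: ifP => _; rewrite ?mulr0 ?mul0r.
Qed.

Hypothesis ms : magnetic_potential e sigma.

Lemma magnetic_adjacency_herm : A \is hermsymmx.
Proof.
apply/is_hermitianmxP; rewrite expr0 scale1r; apply/matrixP => i j.
rewrite [RHS]mxE [A^T i j]mxE !magnetic_adjacencyE e_sym.
case: ifP => [eji|]; last by rewrite conjC0.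
have [nji ->] := ms eji.
by rewrite invC_norm nji expr1n invr1 mul1r.
Qed.

(** Going along an edge and back contributes [sigma x z * sigma z x = 1], so
    the entry counts the neighbours of the vertex. *)
Lemma magnetic_adjacency_sqr_diag i : (A *m A) i i = d%:R.
Proof.
rewrite magnetic_adjacency_sqrE -(e_reg (v i)) -sum1_card natr_sum.
apply: eq_big => [z|z /andP[/ms[nz ->] _]]; first by rewrite [e z _]e_sym andbb.
by rewrite mulfV// -normr_eq0 nz oner_eq0.
Qed.

Lemma leigenvalue_col (a : R[i]) (c : 'cV_n) :
  c != 0 -> A *m c = a *: c ->
  leigenvalue (magnetic_laplacian e sigma) (d%:R - a).
Proof.
case: v_bij => w vK wK c0 Ac.
pose f : {ffun V -> R[i]^o} := [ffun x => c (w x) 0].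
have fE : \col_i (f (v i) : R[i]) = c by apply/colP => i; rewrite mxE ffunE vK.
apply/magnetic_eigenvalueP; exists f.
  apply: contraNneq c0 => f0; rewrite -fE f0.
  by apply/eqP/colP => i; rewrite !mxE ffunE.
apply/ffunP => x; move: (magnetic_adjacency_col f); rewrite fE Ac.
move=> /colP/(_ (w x)); rewrite !mxE wK => /eqP.
rewrite eq_sym subr_eq addrC -subr_eq => /eqP <-.
by rewrite !ffunE /GRing.scale /= mulrBl.
Qed.

Lemma adjacency_sqr_op : A *m A = d%:R%:M ->
  let T := d%:R *: \1%VF - magnetic_laplacian e sigma in
  forall f, T (T f) = d%:R *: f.
Proof.
move=> AA T f; apply/ffunP => y; case: v_bij => w vK wK.
have colT g : \col_i (T g (v i) : R[i]) = A *m \col_i (g (v i) : R[i]).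
  rewrite magnetic_adjacency_col; apply/colP => i.
  by rewrite [LHS]mxE [RHS]mxE !lfun_simp !ffunE.
have := colT (T f); rewrite (colT f) mulmxA AA mul_scalar_mx => /colP/(_ (w y)).
by rewrite [LHS]mxE [RHS]mxE mxE wK => ->; rewrite ffunE.
Qed.

End Enumeration.

(** * Symmetry of the spectrum of a bipartite graph *)

Definition sign_flip (B : {set V}) (f : {ffun V -> R[i]^o}) :
    {ffun V -> R[i]^o} :=
  [ffun x => (-1) ^+ (x \in B) * f x].

Lemma sign_flip_is_linear B : linear (sign_flip B).
Proof.
move=> a f g; apply/ffunP => x; rewrite !ffunE /GRing.scale /= mulrDr.
by rewrite mulrCA.
Qed.

HB.instance Definition _ B :=
  GRing.isLinear.Build R[i] {ffun V -> R[i]^o} {ffun V -> R[i]^o} _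
    (sign_flip B) (sign_flip_is_linear B).

Lemma sign_flipK B : involutive (sign_flip B).
Proof. by move=> f; apply/ffunP => x; rewrite !ffunE signrMK. Qed.

(** The sign changes along every edge, so [sign_flip B] anticommutes with the
    adjacency operator [d - Delta]. *)
Lemma laplacian_sign_flip (B : {set V}) sigma f x :
  (forall x y : V, e x y -> (x \in B) != (y \in B)) ->
  magnetic_laplacian e sigma (sign_flip B f) x =
  (-1) ^+ (x \in B) * (2 * d%:R * f x - magnetic_laplacian e sigma f x).
Proof.
move=> Bbip; rewrite !laplacian_regular ffunE.
have -> : \sum_(y | e x y) sigma x y * sign_flip B f y =
    - ((-1) ^+ (x \in B) * \sum_(y | e x y) sigma x y * f y).
  rewrite mulr_sumr -sumrN; apply: eq_bigr => y /Bbip.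
  rewrite ffunE; case: (x \in B); case: (y \in B) => // _;
    by rewrite ?expr1 ?expr0 !(mul1r, mulN1r) ?mulrN ?opprK.
rewrite opprK opprB -mulrA [2 * _]mulr_natl mulr2n [_ + _ + (_ - _)]addrC subrKA.
by rewrite mulrDr addrC mulrCA.
Qed.

Hypothesis e_bip : bipartite e.

(** The sign flip embeds each eigenspace into the reflected one, and the
    reflection is an involution.  The relation between [a] and [b] is kept
    symmetric, as a hypothesis, so that either can play the role of the given
    eigenvalue. *)
Lemma dim_leigenspace_reflect sigma (a b : R[i]) : a + b = 2 * d%:R ->
  \dim (leigenspace (magnetic_laplacian e sigma) a) =
  \dim (leigenspace (magnetic_laplacian e sigma) b).
Proof.
suff le_dim (k l : R[i]) : k + l = 2 * d%:R ->
    (\dim (leigenspace (magnetic_laplacian e sigma) k) <=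
     \dim (leigenspace (magnetic_laplacian e sigma) l))%N.
  move=> ab; apply: anti_leq; apply/andP.
  by split; apply: le_dim => //; rewrite addrC.
move=> kl; have [B Bbip] := e_bip.
have kerS : lker (linfun (sign_flip B)) = 0%VS.
  apply/eqP/lker0P => f g; rewrite !lfunE; exact: (inv_inj (sign_flipK B)).
apply: (dim_le_injective kerS) => f /memv_leigenspaceP fk.
apply/memv_leigenspaceP; rewrite [linfun (sign_flip B) f]lfunE /=.
apply/ffunP => x; rewrite (laplacian_sign_flip _ _ _ Bbip) fk.
by rewrite !ffunE /GRing.scale /= -kl mulrDl addrAC subrr add0r mulrCA.
Qed.

Lemma leigenvalue_reflect sigma a :
  leigenvalue (magnetic_laplacian e sigma) a ->
  leigenvalue (magnetic_laplacian e sigma) (2 * d%:R - a).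
Proof.
rewrite /leigenvalue => /negP a_eig; apply/eqP => E0; apply: a_eig.
have := dim_leigenspace_reflect sigma (subrK a (2 * d%:R)).
by rewrite E0 dimv0 -dimv_eq0 => <-.
Qed.

(** * The trace bound and its equality case *)

Hypothesis V_gt0 : (0 < #|V|)%N.

Section Potential.
Variables (sigma : V -> V -> R[i]) (ms : magnetic_potential e sigma).
Variables (n : nat) (v : 'I_n -> V) (v_bij : bijective v).
Let L := lambda1 e sigma.
Let A := magnetic_adjacency e d v sigma.

(** The reflection [2 * d - L] of the smallest eigenvalue is an eigenvalue, so
    it is at least [L]. *)
Lemma lambda1_le_degree : 0 <= d%:R - L.
Proof.
have [L_eig L_min] := lambda1_min e_sym V_gt0 ms.
have := L_min _ (leigenvalue_reflect L_eig).
rewrite -/L -(rmorph_nat (real_complex R)) -(rmorph_nat (real_complex R) d).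
rewrite -rmorphM -rmorphB lecR /=.
rewrite mulr_natl mulr2n lerBrDr -mulr2n -mulr2n lerMn2r /=.
by rewrite subr_ge0.
Qed.

(** Both [d - a] and its reflection [d + a] are at least [L] when [a] is an
    eigenvalue of [A]; so the absolute value of [a] is at most [d - L], and
    [tr_sqr_hermitian] applies with the known trace [d *+ n]. *)
Lemma degree_le_sqr_gap :
  d%:R <= (d%:R - L) ^+ 2 /\ ((d%:R - L) ^+ 2 = d%:R -> A *m A = d%:R%:M).
Proof.
have [L_eig L_min] := lambda1_min e_sym V_gt0 ms.
have bnd a (c : 'cV_n) : c != 0 -> A *m c = a *: c ->
    a ^+ 2 <= ((d%:R - L) ^+ 2)%:C.
  move=> c0 Ac; have eig := leigenvalue_col v_bij c0 Ac.
  have a_real : a \is Num.real.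
    rewrite -[a](subKr d%:R) rpredB ?realn//.
    exact: magnetic_eigenvalue_real eig.
  have aE := RRe_real a_real.
  move: (L_min _ eig) (L_min _ (leigenvalue_reflect eig)).
  rewrite opprB mulr_natl mulr2n addrACA subrr addr0 -aE.
  rewrite -(rmorph_nat (real_complex R)) -rmorphB -rmorphD -rmorphXn !lecR /=.
  rewrite -/L => le1 le2.
  rewrite -real_normK ?num_real// ler_sqr ?nnegrE ?normr_ge0 ?lambda1_le_degree//.
  by rewrite ler_norml lerNl !lerBrDr [- _ + L]addrC lerBlDr le2 addrC -lerBrDr.
have n_gt0 : (0 < n)%N.
  have /card_gt0P[x _] := V_gt0; case: v_bij => w _ _.
  exact: leq_ltn_trans (ltn_ord (w x)).
have trE : \tr (A *m A) = d%:R *+ n.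
  rewrite /mxtrace (eq_bigr (fun=> d%:R)) ?sumr_const ?card_ord// => i _.
  exact: magnetic_adjacency_sqr_diag.
have [] := tr_sqr_hermitian (magnetic_adjacency_herm v_bij ms) bnd.
rewrite -/A trE => le_tr eq_tr; split.
  move: le_tr; rewrite lerMn2r eqn0Ngt n_gt0 /=.
  by rewrite -(rmorph_nat (real_complex R)) lecR.
by move=> E; rewrite eq_tr E rmorph_nat.
Qed.

Lemma lambda1_le : L <= d%:R - Num.sqrt d%:R.
Proof.
have [le_d _] := degree_le_sqr_gap.
rewrite lerBrDr addrC -lerBrDr -[leRHS]ger0_norm ?lambda1_le_degree//.
by rewrite -sqrtr_sqr ler_sqrt ?sqr_ge0.
Qed.

Lemma adjacency_sqr_root : A *m A = d%:R%:M ->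
  let T := d%:R *: \1%VF - magnetic_laplacian e sigma in
  forall f, T (T f) = (Num.sqrt d%:R)%:C ^+ 2 *: f.
Proof.
move=> AA T f; rewrite (adjacency_sqr_op v_bij AA f) -rmorphXn sqr_sqrtr ?ler0n//.
by rewrite rmorph_nat.
Qed.

Lemma leigenvalue_sqr_adjacency (a : R[i]) : A *m A = d%:R%:M ->
  leigenvalue (magnetic_laplacian e sigma) a ->
  a = (d%:R - Num.sqrt d%:R)%:C \/ a = (d%:R + Num.sqrt d%:R)%:C.
Proof.
move=> /adjacency_sqr_root TT; rewrite rmorphB rmorphD !rmorph_nat /=.
rewrite -{1}(subKr d%:R a) /leigenvalue -leigenspace_subr.
move=> /(leigenvalue_sqr_scalar TT)[aE|aE]; [left|right].
  by rewrite -aE subKr.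
by rewrite -[a](subKr d%:R) aE opprK.
Qed.

Lemma lambda1_eq_sqr_adjacency : L = d%:R - Num.sqrt d%:R <-> A *m A = d%:R%:M.
Proof.
have [_ eqA] := degree_le_sqr_gap; split=> [LE|AA].
  by apply: eqA; rewrite LE subKr sqr_sqrtr ?ler0n.
have [/(leigenvalue_sqr_adjacency AA) L_eig _] := lambda1_min e_sym V_gt0 ms.
have := lambda1_le_degree.
(* If [L] were [d + sqrt d], then [L <= d] would force [sqrt d = 0]. *)
case: L_eig => /(congr1 (@complex.Re R)) /= E; rewrite /L E //.
rewrite opprD addNKr oppr_ge0 => le0; have -> : Num.sqrt d%:R = 0 :> R.
  by apply: le_anti; rewrite le0 sqrtr_ge0.
by rewrite oppr0.
Qed.

Lemma dim_two_eigenspaces : (0 < d)%N -> A *m A = d%:R%:M ->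
  (\dim (leigenspace (magnetic_laplacian e sigma) (d%:R - Num.sqrt d%:R)%:C) +
   \dim (leigenspace (magnetic_laplacian e sigma) (d%:R + Num.sqrt d%:R)%:C))%N
  = #|V|.
Proof.
move=> d_gt0 /adjacency_sqr_root TT.
have q0 : 2 * (Num.sqrt d%:R)%:C != 0 :> R[i].
  by rewrite mulf_eq0 pnatr_eq0 /= fmorph_eq0 gt_eqF// sqrtr_gt0 ltr0n.
have := dim_sqr_scalar TT q0; rewrite !leigenspace_subr opprK dimvf.
rewrite rmorphB rmorphD !rmorph_nat => ->; exact: muln1.
Qed.

(** Equal dimensions that add up to [#|V|] are each half of it; in particular
    both eigenspaces are nonzero, so that both values are eigenvalues. *)
Lemma spectrum_of_sqr_adjacency : (0 < d)%N -> A *m A = d%:R%:M ->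
  [/\ forall a : R[i], leigenvalue (magnetic_laplacian e sigma) a <->
        a = (d%:R - Num.sqrt d%:R)%:C \/ a = (d%:R + Num.sqrt d%:R)%:C,
      (\dim (leigenspace (magnetic_laplacian e sigma)
        (d%:R - Num.sqrt d%:R)%:C) * 2)%N = #|V| &
      (\dim (leigenspace (magnetic_laplacian e sigma)
        (d%:R + Num.sqrt d%:R)%:C) * 2)%N = #|V|].
Proof.
have double_half (k l N : nat) :
    k = l -> (k + l)%N = N -> (k * 2)%N = N /\ (l * 2)%N = N.
  by move=> -> <-; rewrite muln2 addnn.
move=> d_gt0 AA.
have dimE : \dim (leigenspace (magnetic_laplacian e sigma)
      (d%:R - Num.sqrt d%:R)%:C) =
    \dim (leigenspace (magnetic_laplacian e sigma) (d%:R + Num.sqrt d%:R)%:C).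
  apply: dim_leigenspace_reflect; rewrite rmorphB rmorphD !rmorph_nat addrACA.
  by rewrite addNr addr0 mulr_natl mulr2n.
have [dim1 dim2] := double_half _ _ _ dimE (dim_two_eigenspaces d_gt0 AA).
have eig_of_dim (a : R[i]) :
    (\dim (leigenspace (magnetic_laplacian e sigma) a) * 2)%N = #|V| ->
    leigenvalue (magnetic_laplacian e sigma) a.
  by move=> dimV; apply: contraTneq V_gt0 => E0; rewrite -dimV E0 dimv0.
split; [|exact: dim1|exact: dim2].
move=> a; split; first exact: leigenvalue_sqr_adjacency.
by case=> ->; apply: eig_of_dim; [exact: dim1|exact: dim2].
Qed.

Lemma lambda1_of_spectrum :
  (forall a : R[i], leigenvalue (magnetic_laplacian e sigma) a <->
     a = (d%:R - Num.sqrt d%:R)%:C \/ a = (d%:R + Num.sqrt d%:R)%:C) ->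
  L = d%:R - Num.sqrt d%:R.
Proof.
move=> spec; have [/spec L_eig L_min] := lambda1_min e_sym V_gt0 ms.
have a1_eig : leigenvalue (magnetic_laplacian e sigma) (d%:R - Num.sqrt d%:R)%:C.
  by apply/spec; left.
apply/eqP; rewrite eq_le -lecR L_min//=.
case: L_eig => /(congr1 (@complex.Re R)) /= E; rewrite /L E //.
by rewrite lerD2l ge0_cp // sqrtr_ge0.
Qed.

(** Two vertices with a common neighbour lie on the same side of the
    bipartition, so no edge joins them and the distance cannot drop to [1]. *)
Lemma at_distance2_iff x y :
  at_distance e 2 x y <-> (x != y) && [exists z, e x z && e z y].
Proof.
have [B Bbip] := e_bip.
split=> [|/andP[xy /existsP[z /andP[xz zy]]]]; last first.
  split; first by exists [:: z; y]; rewrite /= xz zy.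
  move=> [|w [|w' p]] //= => [_ yx|/andP[xw _] wy]; first by rewrite yx eqxx in xy.
  move: (Bbip _ _ xz) (Bbip _ _ zy) (Bbip _ _ xw); rewrite wy.
  by do 3 case: (_ \in B).
move=> [[p [p_path p_end p2]] short]; apply/andP; split.
  by apply/eqP => xy; have := short [::] isT xy.
case: p p2 p_path p_end => [|z [|w []]] //= _ /and3P[xz zw _] wy.
by apply/existsP; exists z; rewrite xz -wy.
Qed.

Lemma sqr_adjacency_distance2 : A *m A = d%:R%:M <->
  forall x y : V, at_distance e 2 x y ->
    \sum_(z | e x z && e z y) sigma x z * sigma z y = 0.
Proof.
split=> [AA x y /at_distance2_iff/andP[xy _]|orth].
  case: v_bij => w _ wK.
  rewrite -(wK x) -(wK y) -magnetic_adjacency_sqrE// -/A AA mxE.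
  by rewrite (inj_eq (can_inj wK)) (negPf xy).
apply/matrixP => i j; rewrite [RHS]mxE; have [<-|ij] := eqVneq i j.
  by rewrite mulr1n magnetic_adjacency_sqr_diag.
rewrite mulr0n magnetic_adjacency_sqrE//.
have [/existsP common|none] := boolP [exists z, e (v i) z && e z (v j)].
  apply: orth; apply/at_distance2_iff; rewrite (inj_eq (bij_inj v_bij)) ij.
  exact/existsP.
by rewrite big_pred0// => z; apply: contraNF none => z_mid; apply/existsP; exists z.
Qed.

End Potential.

(** * The magneto-spectral height *)

Lemma unit_potential : magnetic_potential e (fun _ _ => 1 : R[i]).
Proof. by move=> x y _; rewrite normr1 invr1. Qed.

(** The supremum of an empty set of reals is a default value, so the bound
    needs some potential to exist: the constant [1] is one. *)
Lemma height_le : magneto_spectral_height R e <= d%:R - Num.sqrt d%:R.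
Proof.
apply: ge_sup.
  exists (lambda1 e (fun _ _ => 1 : R[i])); exists (fun _ _ => 1 : R[i]) => //.
  exact: unit_potential.
move=> _ [sigma ms <-]; apply: (lambda1_le ms (v := enum_val)).
exact: enum_val_bij.
Qed.

Lemma maximal_of_lambda1_eq sigma : magnetic_potential e sigma ->
  lambda1 e sigma = d%:R - Num.sqrt d%:R -> maximal_potential e sigma.
Proof.
move=> ms LE; split=> //; apply/eqP; rewrite eq_le {2}LE height_le andbT.
apply: ub_le_sup; last by exists sigma.
exists (d%:R - Num.sqrt d%:R) => _ [tau mt <-].
by apply: (lambda1_le mt (v := enum_val)); exact: enum_val_bij.
Qed.

End Magnetic.

Theorem proposition3p3 (R : realType) (V : finType) (e : rel V) (d : nat)
    (e_sym : symmetric e) (e_irr : irreflexive e) (V_gt0 : (0 < #|V|)%N)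
    (e_reg : regular e d) (e_bip : bipartite e) :
  magneto_spectral_height R e <= d%:R - Num.sqrt d%:R /\
  forall sigma : V -> V -> R[i], magnetic_potential e sigma ->
  forall v : 'I_#|V| -> V, bijective v ->
  let Delta := magnetic_laplacian e sigma in
  let A := magnetic_adjacency e d v sigma in
  let a1 : R[i] := (d%:R - Num.sqrt d%:R)%:C in
  let a2 : R[i] := (d%:R + Num.sqrt d%:R)%:C in
  let i := lambda1 e sigma = d%:R - Num.sqrt d%:R in
  let ii := A *m A = d%:R%:M in
  let iii :=
    [/\ forall a : R[i], leigenvalue Delta a <-> a = a1 \/ a = a2,
        (\dim (leigenspace Delta a1) * 2)%N = #|V| &
        (\dim (leigenspace Delta a2) * 2)%N = #|V|] in
  let iv := forall x y : V, at_distance e 2 x y ->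
    \sum_(z | e x z && e z y) sigma x z * sigma z y = 0 in
  [/\ i -> maximal_potential e sigma,
      i <-> ii,
      (0 < d)%N -> (i <-> iii) &
      i <-> iv].
Proof.
split; first exact: height_le.
move=> sigma ms v v_bij Delta A a1 a2 i ii iii iv.
have i_ii : i <-> ii by exact: lambda1_eq_sqr_adjacency.
split=> //; first exact: maximal_of_lambda1_eq.
  move=> d_gt0; split=> [/i_ii|[spec _ _]]; first exact: spectrum_of_sqr_adjacency.
  exact: lambda1_of_spectrum.
by rewrite i_ii; exact: sqr_adjacency_distance2.
Qed.
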